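(* Let $p$ be an odd prime. Then $$\sum_{k=0}^{\frac{p-1}2}\frac{\binom{2k}k^2}{32^k}\equiv\begin{cases}0\pmod{p^2}&\text{if }4\mid p-3,\\ 2a-\frac{p}{2a}\pmod{p^2}&\text{if }4\mid p-1\text{ and }p=a^2+b^2\text{ with }a,b\in\mathbb Z,\ 4\mid a-1.\end{cases}$$
   Context: Congruences are between rational numbers whose denominators are prime to $p$. *)

(* Defs.v *)
From HB Require Import structures.
From mathcomp Require Import all_boot all_order all_algebra.
Set Implicit Arguments. Unset Strict Implicit. Unset Printing Implicit Defensive.
Import Order.TTheory GRing.Theory Num.Theory.
Local Open Scope ring_scope.

(* Congruence of rationals modulo a positive integer m: x = y (mod m) iff
   the rational x - y, written in lowest terms n/d, has d coprime to m
   and m dividing n (i.e. x - y lies in m * Z_(m)). *)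
Definition rat_eqmod (m : nat) (x y : rat) : bool :=
  coprime m `|denq (x - y)|%N && ((m%:Z) %| numq (x - y))%Z.

Definition S32 (p : nat) : rat :=
  \sum_(k < (p.-1)./2.+1) ('C(k.*2, k) ^ 2)%:R / (32%:R ^+ k).

(* Main.v *)
Require Import Defs.
From HB Require Import structures.
From mathcomp Require Import all_boot all_order all_algebra.
From mathcomp Require Import cyclic finfield zify ring.
Set Implicit Arguments. Unset Strict Implicit. Unset Printing Implicit Defensive.
Import Order.TTheory GRing.Theory Num.Theory.
Local Open Scope ring_scope.

(** Put [n = (p-1)/2]. Modulo [p^2], [C(2k,k) = C(n+k,2k) (-16)^k], so the sum
becomes the value at 0 of the Legendre polynomial [P_n], that is [2^-n] times the
coefficient of [X^n] in [(1 - X^2)^n]. It vanishes for [n] odd and equals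
[(-1)^m C(2m,m) / 2^n] for [n = 2m].

For [p = 4m+1] let [T] be the Teichmüller character modulo [p^2] and [J] the
Jacobi sum [sum_x T(x)^(3m) T(1-x)^(2m)]. Splitting the sum over squares and
nonsquares gives [J = c + e d] with [e^2 = -1], where [2c] and [2d] are Jacobsthal
sums, [c^2 + d^2 = p], and [c] is determined modulo 4; hence [c = a] or [c = -a]
according to the parity of [m], and [J^2 - 2cJ + p = 0].
On the other hand [T(1-x) = (1 - T(x))^p = 1 - T(x) + p f(x)] with
[f(x) = - sum_(0<j<p) x^j / j]. Expanding the powers shows that [J] equals
[- (-1)^m C(2m,m)] up to a correction divisible by [p]; by a binomial identity this
correction involves only [f(-1)], which is the Fermat quotient of 2 up to a factor,
and the same expansion of [T(2)^n = (2/p)] turns the result into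
[2^n J = - C(2m,m)]. So [- (-1)^m J] is both the sum and the unit root of
[X^2 - 2aX + p], which is [2a - p/(2a)] modulo [p^2]. *)

(** * Alternating binomial sums *)

Lemma eq_signr (A : pzRingType) (a b : nat) :
  odd a = odd b -> (-1) ^+ a = (-1) ^+ b :> A.
Proof. by rewrite -signr_odd -[(-1) ^+ b]signr_odd => ->. Qed.

(** Pascal's rule makes the partial sums of row [N.+1] telescope. *)
Lemma sum_alt_bin (A : nzRingType) (N k : nat) :
  \sum_(i < k.+1) (-1) ^+ i * 'C(N.+1, i)%:R = (-1) ^+ k * 'C(N, k)%:R :> A.
Proof.
elim: k => [|k IH]; first by rewrite big_ord1 !bin0.
rewrite big_ord_recr /= IH binS natrD mulrDr exprS !mulN1r !mulNr.
by rewrite addrC addrNK.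
Qed.

Lemma expr_one_sub (A : comNzRingType) (x : A) (n : nat) :
  (1 - x) ^+ n = \sum_(i < n.+1) (-1) ^+ i * 'C(n, i)%:R * x ^+ i.
Proof.
rewrite exprBn; apply: eq_bigr => i _.
by rewrite expr1n mulr1 mulrAC mulr_natr.
Qed.

Lemma coef_one_subX2 (A : comNzRingType) (n : nat) :
  ((1 - 'X^2) ^+ n)`_n =
  (if odd n then 0 else (-1) ^+ n./2 * 'C(n, n./2)%:R) :> A.
Proof.
rewrite expr_one_sub coef_sum.
have cE (i : 'I_n.+1) : ((-1) ^+ i * 'C(n, i)%:R * 'X^2 ^+ i : {poly A})`_n
   = (-1) ^+ i * 'C(n, i)%:R * (n == (2 * i)%N)%:R.
  rewrite -exprM -(polyC1 A) -polyCN -polyC_exp -polyC_natr -polyCM.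
  by rewrite coefCM coefXn.
under eq_bigr => i _ do rewrite cE.
case: ifP => [on|en].
  by rewrite big1 // => i _; case: eqP => [ne|_]; [lia | rewrite mulr0].
have hn : (n./2 < n.+1)%N by lia.
rewrite (bigD1 (Ordinal hn)) //= big1 ?addr0 => [|i ne].
  rewrite (_ : (n == 2 * n./2)%N) ?mulr1 //; apply/eqP.
  by have := odd_double_half n; rewrite en; lia.
rewrite (_ : (n == 2 * i)%N = false) ?mulr0 //; apply/negP => /eqP nE.
by move/eqP: ne; apply; apply: val_inj => /=; lia.
Qed.

(** With [h] = 1/2 the left side is the Legendre polynomial [P_n] at 0. As
    [h (1 - X) = 1 - h (1 + X)], the polynomial [h^n (1 - X^2)^n] expands in powers of [1 + X]; both
    sides are its coefficient of [X^n]. *)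
Lemma legendre0 (A : comNzRingType) (h : A) (n : nat) : h *+ 2 = 1 ->
  \sum_(k < n.+1) 'C(n, k)%:R * 'C(n + k, k)%:R * (- h) ^+ k =
  h ^+ n * (if odd n then 0 else (-1) ^+ n./2 * 'C(n, n./2)%:R) :> A.
Proof.
move=> h2; rewrite -coef_one_subX2 -coefCM.
have -> : (h ^+ n)%:P * (1 - 'X^2) ^+ n =
   \sum_(k < n.+1) ('C(n, k)%:R * (- h) ^+ k)%:P * (1 + 'X) ^+ (n + k).
  transitivity ((1 + 'X) ^+ n * (1 - h%:P * (1 + 'X)) ^+ n).
    rewrite polyC_exp -!exprMn; congr (_ ^+ n).
    have -> : 1 - h%:P * (1 + 'X) = h%:P * (1 - 'X).
      by rewrite -[X in X - _](polyC1 A) -h2 mulr2n polyCD; ring.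
    ring.
  rewrite expr_one_sub mulr_sumr; apply: eq_bigr => k _.
  rewrite [(h%:P * _) ^+ k]exprMn exprD polyCM polyC_exp polyCN polyC_natr.
  by rewrite [(- h%:P) ^+ k]exprNn; ring.
rewrite coef_sum; apply: eq_bigr => k _.
have -> : (1 + 'X) ^+ (n + k) = \sum_(i < (n + k).+1) 'C(n + k, i)%:R *: 'X^i :> {poly A}.
  by rewrite addrC exprD1n; apply: eq_bigr => i _; rewrite scaler_nat.
rewrite coefCM coef_sum.
have hn : (n < (n + k).+1)%N by lia.
rewrite (bigD1 (Ordinal hn)) //= big1 => [|i ne]; last first.
  rewrite coefZ coefXn (_ : (n == i)%N = false) ?mulr0 //; apply/negP => /eqP nE.
  by move/eqP: ne; apply; apply: val_inj.
rewrite addr0 coefZ coefXn eqxx mulr1.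
by rewrite -(@bin_sub (n + k) n) ?leq_addr // addKn; ring.
Qed.

(** * Reduction of the central binomial sum modulo the square of [2n + 1] *)

Lemma central_binS (k : nat) :
  ('C(k.+1.*2, k.+1) * k.+1 = 'C(k.*2, k) * (2 * k.*2.+1))%N.
Proof.
  have := mul_bin_diag k.*2.+2 k; have := mul_bin_diag k.*2.+1 k; rewrite /=.
  have : 'C(k.*2.+1, k.+1) = 'C(k.*2.+1, k).
    by have <- : (k.*2.+1 - k = k.+1)%N by [lia]; rewrite bin_sub //; lia.
  by rewrite doubleS => ->; move: 'C(_, _) 'C(_, _) 'C(_, _) => x y z; lia.
Qed.

(** Compare the ratios of consecutive terms in [k]: since [4 (n + k + 1) (n - k) = (2n + 1)^2 - (2k
    + 1)^2] and [(2n + 1)^2 = 0], they agree. The invertibility of the integers up to [2n] permits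
    the cancellation. *)
Lemma bin_double_congr (A : comUnitRingType) (n k : nat) :
    ((n.*2.+1)%:R ^+ 2 = 0 :> A) ->
    (forall j, (0 < j <= n.*2)%N -> (j%:R : A) \is a GRing.unit) ->
    (k <= n)%N ->
  'C(k.*2, k)%:R = 'C(n + k, k.*2)%:R * (- 16%:R) ^+ k :> A.
Proof.
move=> n0 un; elim: k => [|k IH] kn; first by rewrite !bin0 mul1r.
have {}IH := IH (ltnW kn).
have u : (((k.*2.+2 * k.*2.+1 * k.+1)%N)%:R : A) \is a GRing.unit.
  by rewrite !natrM !unitrM !un; lia.
apply: (mulrI u).
have e1 : ('C(n + k.+1, k.*2.+2) * (k.*2.+2 * k.*2.+1) =
           'C(n + k, k.*2) * ((n + k).+1 * (n - k)))%N.
  have := mul_bin_diag (n + k.+1) k.*2.+1; have := mul_bin_left (n + k) k.*2.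
  rewrite addnS /= (_ : n + k - k.*2 = n - k)%N; last by lia.
  move=> h1 h2; rewrite mulnA [('C(_, _) * _)%N]mulnC -h2.
  by rewrite -mulnA [('C(_, _) * _)%N]mulnC h1; lia.
have e2 := central_binS k.
have e3 : (n + k).+1%:R * (n - k)%:R * (4%:R) = - (k.*2.+1)%:R ^+ 2 :> A.
  apply/eqP; rewrite -addr_eq0 -n0 -!natrM -!natrX -natrD; apply/eqP.
  congr (_%:R); rewrite -(subnK kn); lia.
rewrite doubleS exprS.
have -> : (k.*2.+2 * k.*2.+1 * k.+1)%:R * 'C(k.*2.+2, k.+1)%:R
   = (k.*2.+2 * k.*2.+1)%:R * 'C(k.*2, k)%:R * (2 * k.*2.+1)%:R :> A.
  by rewrite -!natrM; congr (_%:R); rewrite -mulnA [(k.+1 * _)%N]mulnC -doubleS e2 mulnA.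
transitivity (('C(n + k.+1, k.*2.+2) * (k.*2.+2 * k.*2.+1))%:R * (k.+1)%:R *
   (- 16%:R * (- 16%:R) ^+ k) :> A); last by rewrite !natrM; ring.
rewrite e1 IH.
transitivity ('C(n + k, k.*2)%:R * (- 16%:R) ^+ k * (- 4%:R * k.+1%:R) *
    ((n + k).+1%:R * (n - k)%:R * (4%:R)) : A); last by rewrite !natrM; ring.
rewrite e3 !natrM (_ : k.*2.+2 = 2 * k.+1)%N ?natrM; last by lia.
ring.
Qed.

(** Both products are the multinomial coefficient [(n + k)! / (k! k! (n - k)!)]. *)
Lemma bin_mul_double (n k : nat) : (k <= n)%N ->
  ('C(n + k, k.*2) * 'C(k.*2, k) = 'C(n, k) * 'C(n + k, k))%N.
Proof.
move=> kn; have /eqP := @bin_fact (n + k) k.*2 ltac:(lia).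
rewrite (_ : n + k - k.*2 = n - k)%N; last by lia.
have := @bin_fact (n + k) k ltac:(lia); rewrite addnK => <-.
rewrite -(bin_fact kn); have := @bin_fact k.*2 k ltac:(lia).
rewrite (_ : k.*2 - k = k)%N => [<-|]; last by lia.
move=> /eqP E.
have := fact_gt0 k; have := fact_gt0 (n - k) => f1 f2.
have f0 : (0 < k`! * k`! * (n - k)`!)%N by rewrite !muln_gt0 f1 f2.
apply/eqP; rewrite -(eqn_pmul2r f0); apply/eqP; lia.
Qed.

(** Replacing one of the two factors [C(2k, k)] by [C(n + k, 2k) (-16)^k] leaves the power
    [(-16/32)^k = (-1/2)^k], so the sum is that of [legendre0] with [h] = 1/2. *)
Lemma sum_central_bin (A : comUnitRingType) (n : nat) :
    ((n.*2.+1)%:R ^+ 2 = 0 :> A) ->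
    (forall j, (0 < j <= n.*2)%N -> (j%:R : A) \is a GRing.unit) ->
    (2%:R : A) \is a GRing.unit ->
  \sum_(k < n.+1) ('C(k.*2, k) ^ 2)%:R / 32%:R ^+ k =
  2%:R ^- n * (if odd n then 0 else (-1) ^+ n./2 * 'C(n, n./2)%:R) :> A.
Proof.
move=> n0 un u2; rewrite -exprVn -legendre0; last by rewrite -[_ *+ 2]mulr_natr mulVr.
apply: eq_bigr => k _; have kn : (k <= n)%N by case: k.
have u32 : (32%:R : A) ^+ k \is a GRing.unit.
  by rewrite unitrX // (_ : 32 = 2 ^ 5)%N // natrX unitrX.
apply: (mulIr u32); rewrite mulrVK // -[RHS]mulrA -exprMn.
have -> : - 2%:R^-1 * 32%:R = - 16%:R :> A.
  by rewrite (_ : 32 = 2 * 16)%N // natrM mulNr mulKr.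
rewrite natrX expr2 {1}(bin_double_congr n0 un kn) mulrAC -!natrM.
by rewrite bin_mul_double.
Qed.

(** The weight [M + 1 - i], which vanishes at the centre of row [2M + 2], makes the alternating sum
    telescope. The case [k = M - 1] is the certificate in [sum_alt_bin_inv]. *)
Lemma sum_alt_bin_weighted (A : comNzRingType) (M k : nat) :
  \sum_(i < k.+2) (-1) ^+ i * ((M.+1)%:R - i%:R) * 'C(M.+1.*2, i)%:R =
  (-1) ^+ k.+1 * M.+1%:R * ('C(M.*2, k.+1)%:R - 'C(M.*2, k)%:R) :> A.
Proof.
elim: k => [|k IH].
  rewrite big_ord_recr big_ord1 /= !bin0 !bin1 expr0 expr1 -!mul2n !natrM; ring.
rewrite big_ord_recr /= IH doubleS.
have := congr1 (GRing.natmul (1 : A)) (mul_bin_diag M.*2.+2 k.+1).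
rewrite /= natrM [in RHS]natrM.
rewrite !binS !natrD !exprS -mul2n => E.
move/eqP: E; rewrite -subr_eq0 => /eqP E.
apply/eqP; rewrite -subr_eq0 -[X in _ == X](mulr0 ((-1) ^+ k)) -E.
apply/eqP; ring.
Qed.

Definition alt_harmonic (F : fieldType) (n : nat) : F :=
  \sum_(k < n) (-1) ^+ k / k.+1%:R.

(** Both sides vanish at [m = 0] and satisfy [(m + 1)^2 S(m + 1) = 2 (2m + 1) (m + 1) S(m) + C(2m,
    m)]. *)
Lemma sum_alt_bin_inv (F : fieldType) (m : nat) :
    (forall k, (0 < k <= m.*2)%N -> k%:R != 0 :> F) ->
  \sum_(j < m) (-1) ^+ j * 'C(m.*2, m - j.+1)%:R / j.+1%:R =
  'C(m.*2, m)%:R * alt_harmonic F m.*2.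
Proof.
elim: m => [|m IH] nz; first by rewrite /alt_harmonic !big_ord0 mulr0.
have {}IH := IH (fun k hk => nz k ltac:(lia)).
have nm : m.+1%:R != 0 :> F by apply: nz; lia.
have n1 : m.*2.+1%:R != 0 :> F by apply: nz; lia.
have n2 : m.*2.+2%:R != 0 :> F by apply: nz; lia.
have cS : 'C(m.+1.*2, m.+1)%:R * m.+1%:R = (2 * m.*2.+1)%:R * 'C(m.*2, m)%:R :> F.
  by rewrite -natrM central_binS mulnC natrM.
(* Read backwards from the centre, this is [sum_alt_bin_weighted], whose sum has at least two terms;
   hence the separate case [m = 0]. *)
have D : \sum_(j < m.+1) (-1) ^+ j * j.+1%:R * 'C(m.+1.*2, m - j)%:R =
    'C(m.*2, m)%:R :> F.
  case: (m) => [|m']; first by rewrite big_ord1 expr0 !mul1r.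
  have := sum_alt_bin_weighted F m'.+1 m'; rewrite (reindex_inj rev_ord_inj) /=.
  have sg (i j : nat) : (i <= j)%N -> (-1) ^+ (j - i) = (-1) ^+ j * (-1) ^+ i :> F.
    by move=> ij; rewrite -[in RHS](subnK ij) exprD -mulrA -expr2 sqrr_sign mulr1.
  rewrite -mulrA.
  have -> : m'.+2%:R * ('C(m'.+1.*2, m'.+1)%:R - 'C(m'.+1.*2, m')%:R) =
    'C(m'.+1.*2, m'.+1)%:R :> F.
    have := mul_bin_left m'.+1.*2 m'; rewrite (_ : m'.+1.*2 - m' = m'.+2)%N; last by lia.
    move/(congr1 (GRing.natmul (1 : F))); rewrite !natrM mulrBr => <-.
    by rewrite -mulrBl -[m'.+2]addn1 natrD addrAC subrr add0r mul1r.
  move=> H; apply: (mulfI (_ : (-1) ^+ m'.+1 != 0 :> F)); first by rewrite signr_eq0.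
  rewrite -{}H mulr_sumr; apply: eq_bigr => i _; have im : (i < m'.+2)%N by case: i.
  rewrite !subSS sg // -natrB; last by lia.
  rewrite (_ : m'.+2 - (m'.+1 - i) = i.+1)%N.
    by rewrite !mulrA.
  lia.
(* Zeilberger's recurrence, with the telescoping sum [D] as certificate. *)
have step : m.+1%:R ^+ 2 *
      (\sum_(j < m.+1) (-1) ^+ j * 'C(m.+1.*2, m.+1 - j.+1)%:R / j.+1%:R)
   = (2 * m.*2.+1)%:R * m.+1%:R *
      (\sum_(j < m) (-1) ^+ j * 'C(m.*2, m - j.+1)%:R / j.+1%:R) +
      'C(m.*2, m)%:R :> F.
  rewrite -D mulr_sumr [in RHS]mulr_sumr !big_ord_recr /=.
  rewrite !subnn !bin0 !mulr1 addrA -big_split /=; congr (_ + _); last first.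
    by rewrite mulrCA expr2 mulfK.
  apply: eq_bigr => j _; have jm : (j < m)%N by case: j.
  have nj : j.+1%:R != 0 :> F by apply: nz; lia.
  have E : (m.*2.+2 * m.*2.+1 * 'C(m.*2, m - j.+1) =
      (m - j) * (m + j.+2) * 'C(m.+1.*2, m.+1 - j.+1))%N.
    have := mul_bin_diag m.*2.+2 (m - j.+1); have := mul_bin_down m.*2.+1 (m - j.+1).
    rewrite subSS /= (_ : m.*2.+1 - (m - j.+1) = m + j.+2)%N; last by lia.
    by rewrite -subSn // subSS doubleS => E1 E2; rewrite -mulnA E1 mulnCA E2 mulnCA mulnA.
  have {}E := congr1 (GRing.natmul (1 : F)) E; rewrite !natrM natrD natrB 1?ltnW // in E.
  rewrite (_ : m.*2.+2 = 2 * m.+1)%N in E; last by lia.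
  rewrite natrM in E.
  apply: (mulIf nj); rewrite mulrDl -!mulrA ![_^-1 * _]mulVf // !mulr1.
  transitivity ((-1) ^+ j * (2 * m.+1%:R * m.*2.+1%:R * 'C(m.*2, m - j.+1)%:R +
      j.+1%:R ^+ 2 * 'C(m.+1.*2, m.+1 - j.+1)%:R) : F).
    by rewrite E; ring.
  by rewrite subSS natrM; ring.
have HS : alt_harmonic F m.+1.*2 = alt_harmonic F m.*2 + (m.*2.+1%:R^-1 - m.*2.+2%:R^-1).
  rewrite /alt_harmonic doubleS !big_ord_recr /= exprS.
  rewrite (_ : (-1) ^+ m.*2 = 1); last by rewrite -signr_odd odd_double.
  by rewrite mulr1 mulN1r div1r -addrA.
apply: (mulfI (mulf_neq0 nm nm)); rewrite -expr2 step IH HS.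
set X := (alt_harmonic _ _ + _ in RHS).
have -> : m.+1%:R ^+ 2 * ('C(m.+1.*2, m.+1)%:R * X) =
    m.+1%:R * ('C(m.+1.*2, m.+1)%:R * m.+1%:R) * X by ring.
rewrite cS /X; move: n2; rewrite (_ : m.*2.+2 = 2 * m.+1)%N; last by lia.
rewrite !natrM mulf_eq0 => /norP[n2 _].
move: n1 nm; rewrite -!mul2n => n1 nm; field.
by rewrite !(addrC 1) natr1 -natrM natr1 nm n1 n2.
Qed.

(** From [2m C(2m - 1, i) = (m + (m - i)) C(2m, i)] the sum splits into the one of [sum_alt_bin_inv]
    and a plain alternating partial sum of row [2m]. *)
Lemma sum_alt_bin_pred_inv (F : fieldType) (m : nat) : (0 < m)%N ->
    (forall k, (0 < k <= m.*2)%N -> k%:R != 0 :> F) ->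
  4%:R * m%:R * \sum_(i < m) (-1) ^+ i * 'C(m.*2.-1, i)%:R / (m - i)%:R =
  - (-1) ^+ m * 'C(m.*2, m)%:R * ((m.*2)%:R * alt_harmonic F m.*2 + 1).
Proof.
move=> m0 nz; have n2m : (m.*2)%:R != 0 :> F by apply: nz; lia.
have sg k : (k < m)%N -> (-1) ^+ (m - k.+1) = - (-1) ^+ m * (-1) ^+ k :> F.
  move=> km; rewrite -[in RHS](subnK km) exprD exprS mulN1r mulrN opprK -mulrA.
  by rewrite -expr2 sqrr_sign mulr1.
have E (i : 'I_m) : (m.*2)%:R * ((-1) ^+ i * 'C(m.*2.-1, i)%:R / (m - i)%:R) =
   m%:R * ((-1) ^+ i * 'C(m.*2, i)%:R / (m - i)%:R) + (-1) ^+ i * 'C(m.*2, i)%:R :> F.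
  have im : (i < m)%N by case: i.
  have ni : (m - i)%:R != 0 :> F by apply: nz; lia.
  have := congr1 (GRing.natmul (1 : F)) (mul_bin_down m.*2 i); rewrite !natrM => e.
  rewrite mulrA mulrCA e (_ : m.*2 - i = m + (m - i))%N; last by lia.
  by rewrite natrD; field.
have -> : 4%:R * m%:R = 2%:R * (m.*2)%:R :> F by rewrite -!natrM; congr _%:R; lia.
rewrite -[LHS]mulrA mulr_sumr. under eq_bigr => i _ do rewrite E.
rewrite big_split /= -mulr_sumr.
have -> : \sum_(i < m) (-1) ^+ i * 'C(m.*2, i)%:R / (m - i)%:R =
   - (-1) ^+ m * ('C(m.*2, m)%:R * alt_harmonic F m.*2).
  rewrite -sum_alt_bin_inv // (reindex_inj rev_ord_inj) /= mulr_sumr.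
  apply: eq_bigr => i _; have im : (i < m)%N by case: i.
  rewrite (_ : m - (m - i.+1) = i.+1)%N; last by lia.
  by rewrite sg // !mulrA.
case: m m0 {nz E sg} n2m => // m _ n2m.
rewrite doubleS sum_alt_bin -doubleS.
have <- : ('C(m.*2.+1, m) * 2 = 'C(m.+1.*2, m.+1))%N.
  have : 'C(m.*2.+1, m.+1) = 'C(m.*2.+1, m).
    by have <- : (m.*2.+1 - m = m.+1)%N by [lia]; rewrite bin_sub //; lia.
  by move=> e; rewrite doubleS binS e; lia.
by rewrite exprS; move: (alt_harmonic _ _) => L; rewrite -!mul2n !natrM; ring.
Qed.

(** * Quadratic character and Jacobsthal sums *)

Section OddFiniteField.
Variables (F : finFieldType) (n : nat).
Hypothesis cardF : #|F| = n.*2.+1.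
Hypothesis n_gt0 : (0 < n)%N.

(** Translation by 1 permutes [F] and adds [#|F|] to the sum of all elements. *)
Lemma natF : (n.*2.+1)%:R = 0 :> F.
Proof.
have : \sum_(x : F) x = \sum_(x : F) x + #|F|%:R.
  by rewrite {1}(reindex_inj (addIr 1)) big_split /= sumr_const.
by rewrite cardF => /eqP; rewrite -subr_eq0 opprD addrA subrr add0r oppr_eq0 => /eqP.
Qed.

Lemma expf_order (x : F) : x != 0 -> x ^+ n.*2 = 1.
Proof. by move=> x0; apply: (mulfI x0); rewrite -exprS -cardF expf_card mulr1. Qed.

Lemma exists_prim_root : exists g : F, n.*2.-primitive_root g.
Proof.
pose rs := [seq x <- enum F | x != 0].
have : has n.*2.-primitive_root rs.
  apply: has_prim_root; first by lia.
  - apply/allP => x; rewrite mem_filter => /andP[x0 _].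
    by apply/unity_rootP; apply: expf_order.
  - by rewrite filter_uniq ?enum_uniq.
  - have := count_predC (pred1 (0 : F)) (enum F).
    rewrite -cardE cardF count_uniq_mem ?enum_uniq // mem_enum size_filter add1n.
    by case=> <-.
by case/hasP => g _; exists g.
Qed.

Lemma prim_root_neq0 (g : F) : n.*2.-primitive_root g -> g != 0.
Proof.
move=> pg; apply/eqP => g0; have /eqP := prim_expr_order pg.
by rewrite g0 expr0n double_eq0 (gtn_eqF n_gt0) eq_sym oner_eq0.
Qed.

(** Multiplication by [g] permutes [F], so the sum is fixed by the factor [h g]. A unit is asked
    for, rather than a nonzero element, because the values may lie in a ring with zero divisors such
    as the integers modulo [p^2]. *)
Lemma sum_multiplicative_eq0 (A : comUnitRingType) (h : F -> A) (g : F) :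
  {morph h : x y / x * y} -> g != 0 -> h g - 1 \is a GRing.unit -> \sum_x h x = 0.
Proof.
move=> hM g0 u; apply: (mulrI u); rewrite mulr0 mulrBl mul1r mulr_sumr.
apply/eqP; rewrite subr_eq0; apply/eqP; rewrite [RHS](reindex_inj (mulfI g0)).
by apply: eq_bigr => x _; rewrite hM.
Qed.

Lemma sum_expf (k : nat) : (0 < k)%N ->
  \sum_(x : F) x ^+ k = - (n.*2 %| k)%:R.
Proof.
move=> k0; have [g pg] := exists_prim_root.
have [dv|ndv] := boolP (n.*2 %| k)%N; last first.
  rewrite oppr0; apply: (sum_multiplicative_eq0 (g := g)).
  - by move=> x y; rewrite exprMn.
  - exact: prim_root_neq0.
  - by rewrite unitfE subr_eq0 -(prim_order_dvd pg).
rewrite (bigD1 0) //= expr0n (gtn_eqF k0) add0r.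
rewrite (eq_bigr (fun=> 1)) => [|x x0]; last first.
  by have [c ->] := dvdnP dv; rewrite mulnC exprM expf_order // expr1n.
rewrite sumr_const (_ : #|_| = #|F|.-1); last first.
  by rewrite -(cardC1 (0 : F)); apply: eq_card => x; rewrite !inE.
by apply/eqP; rewrite -addr_eq0 cardF natr1 natF.
Qed.

Lemma two_neq0 : 2%:R != 0 :> F.
Proof.
apply/eqP => t0; have := natF; rewrite -natr1 -muln2 natrM t0 mulr0 add0r.
by apply/eqP/oner_neq0.
Qed.

(** Integer-valued, so that the Jacobsthal sums are integers, which can be bounded, compared with
    [a] and reduced modulo 4. *)
Definition quad_char (x : F) : int :=
  if x == 0 then 0 else if x ^+ n == 1 then 1 else -1.

Lemma quad_char_exp (x : F) : (quad_char x)%:~R = x ^+ n :> F.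
Proof.
rewrite /quad_char; case: eqP => [->|/eqP x0]; first by rewrite expr0n; case: (n) n_gt0.
have := expf_order x0; rewrite -muln2 exprM => /eqP.
by rewrite sqrf_eq1 => /orP[]/eqP ->; rewrite ?eqxx //; case: ifP => [/eqP ->|].
Qed.

Lemma quad_charM : {morph quad_char : x y / x * y}.
Proof.
move=> x y; rewrite /quad_char mulf_eq0 exprMn.
have [x0|x0] := eqVneq x 0; first by rewrite mul0r.
have [y0|y0] := eqVneq y 0; first by rewrite mulr0.
have N1 : (-1 == 1 :> F) = false.
  by rewrite eq_sym -addr_eq0 (negPf two_neq0).
have E (z : F) : z != 0 -> z ^+ n = 1 \/ z ^+ n = -1.
  move=> z0; have := expf_order z0; rewrite -muln2 exprM => /eqP.
  by rewrite sqrf_eq1 => /orP[]/eqP; auto.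
by case: (E _ x0) => ->; case: (E _ y0) => ->; rewrite ?mulrNN ?mulr1 ?mul1r ?eqxx ?N1.
Qed.

Lemma card_sqrt (k : F) : #|[pred t : F | t ^+ 2 == k]|%:Z = 1 + quad_char k.
Proof.
rewrite /quad_char; have [->|k0] := eqVneq k 0.
  rewrite (eq_card (B := pred1 0)) ?card1 // => t.
  by rewrite !inE expf_eq0.
have N1 : (-1 == 1 :> F) = false.
  by rewrite eq_sym -addr_eq0 (negPf two_neq0).
have [g pg] := exists_prim_root.
have [[i _] /= ik] := prim_rootP pg (expf_order k0).
case: ifP => kn.
  have : (n.*2 %| i * n)%N by rewrite (prim_order_dvd pg) exprM -ik.
  rewrite -muln2 mulnC dvdn_pmul2r // => /dvdnP[c ci].
  have k2 : (g ^+ c) ^+ 2 = k by rewrite -exprM -ci -ik.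
  rewrite (eq_card (B := pred2 (g ^+ c) (- g ^+ c))); last first.
    by move=> t; rewrite !inE -k2 eqf_sqr.
  have c0 : g ^+ c != 0 by apply: contraNneq k0 => c0; rewrite -k2 c0 expr0n.
  by rewrite card2 -addr_eq0 -mulr2n -mulr_natr mulf_eq0 (negPf c0) (negPf two_neq0).
rewrite eq_card0 // => t; rewrite !inE; apply: contraFF kn => /eqP tk.
rewrite -tk -exprM mul2n expf_order //; apply: contraNneq k0 => t0.
by rewrite -tk t0 expr0n.
Qed.

Lemma sum_sqr (A : nzRingType) (h : F -> A) :
  \sum_t h (t ^+ 2) = \sum_k (1 + quad_char k)%:~R * h k.
Proof.
rewrite (partition_big (fun t => t ^+ 2) predT) //=; apply: eq_bigr => k _.
rewrite -card_sqrt (eq_bigr (fun=> h k)) => [|t /eqP -> //].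
by rewrite sumr_const mulr_natl.
Qed.

Lemma quad_char0 : quad_char 0 = 0. Proof. by rewrite /quad_char eqxx. Qed.

Lemma quad_char1 : quad_char 1 = 1.
Proof. by rewrite /quad_char oner_eq0 expr1n eqxx. Qed.

Lemma quad_char_sqr (x : F) : x != 0 -> quad_char x * quad_char x = 1.
Proof. by rewrite /quad_char => /negPf ->; case: ifP. Qed.

Lemma sum_quad_char : \sum_x quad_char x = 0.
Proof.
have := sum_sqr (fun=> 1 : int); under [RHS]eq_bigr => k _ do rewrite intz mulr1.
rewrite big_split /= => /eqP; rewrite -[X in X == _]addr0 (inj_eq (addrI _)).
by move/eqP <-.
Qed.

Lemma sum_quad_char_affine (u v : F) : v != 0 -> \sum_x quad_char (u + v * x) = 0.
Proof.
move=> v0; transitivity (\sum_x quad_char x); last exact: sum_quad_char.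
by rewrite [RHS](reindex_inj (addrI u)) [RHS](reindex_inj (mulfI v0)).
Qed.

(** The families [t^2] and [g t^2] together hit every element exactly twice: 0 once each, a nonzero
    element twice in one of them. *)
Lemma sum_sqr_split (A : nzRingType) (h : F -> A) (g : F) : quad_char g = -1 ->
  \sum_t h (t ^+ 2) + \sum_t h (g * t ^+ 2) = (\sum_k h k) *+ 2.
Proof.
move=> cg; have g0 : g != 0 by apply: contra_eqN cg => /eqP ->; rewrite quad_char0.
rewrite (sum_sqr h) (sum_sqr (fun k => h (g * k))) [X in X + _](reindex_inj (mulfI g0)).
rewrite [in RHS](reindex_inj (mulfI g0)) -big_split -sumrMnl /=; apply: eq_bigr => k _.
rewrite quad_charM cg mulN1r -mulrDl -intrD addrACA addNr addr0.
by rewrite -[1 + 1]/(2%:Z) mulr2n -mulr2n mulr_natl.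
Qed.

(** For [u != v], shift [k] by [u] and divide by the square [k^2]: the terms become the character of
    [1 + (u - v) / k]. As [1/k] runs over the nonzero elements, they add up to a full sum, which is
    0, minus the value 1 at 0. *)
Lemma quad_char_corr (u v : F) :
  \sum_k quad_char (k - u) * quad_char (k - v) = #|F|%:Z * (u == v)%:R - 1.
Proof.
rewrite (reindex_inj (addIr u)) /=.
have [<-|uv] := eqVneq u v.
  rewrite (bigD1 0) //= add0r subrr quad_char0 mul0r add0r.
  rewrite (eq_bigr (fun=> 1)) => [|k k0]; last by rewrite addrK quad_char_sqr.
  rewrite sumr_const (_ : #|_| = #|F|.-1); last first.
    by rewrite -(cardC1 (0 : F)); apply: eq_card => x; rewrite !inE.
  by rewrite cardF /= natz; lia.
rewrite mulr0 add0r (bigD1 0) //= add0r subrr quad_char0 mul0r add0r.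
have := sum_quad_char_affine 1 (_ : u - v != 0); rewrite subr_eq0 => /(_ uv).
rewrite (reindex_inj invr_inj) (bigD1 0) //= invr0 mulr0 addr0 quad_char1.
move/eqP; rewrite addrC addr_eq0 => /eqP <-; apply: eq_bigr => k k0.
rewrite addrK -addrA -quad_charM.
have -> : k * (k + (u - v)) = k * k * (1 + (u - v) / k) by field.
by rewrite 2!quad_charM quad_char_sqr // mul1r.
Qed.

(** The factor [1 - k y^2] is what [1 - x] becomes in the Jacobi sum under [x = k y^2]. *)
Definition jacobsthal (k : F) : int :=
  \sum_y quad_char y * quad_char (1 - k * y ^+ 2).

Lemma jacobsthal_scale (k t : F) :
  jacobsthal (k * t ^+ 2) = quad_char t * jacobsthal k.
Proof.
have [->|t0] := eqVneq t 0.
  rewrite quad_char0 mul0r /jacobsthal.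
  transitivity (\sum_x quad_char x); last exact: sum_quad_char.
  apply: eq_bigr => y _.
  by rewrite expr0n mulr0 mul0r subr0 quad_char1 mulr1.
rewrite /jacobsthal [in RHS](reindex_inj (mulfI t0)) mulr_sumr; apply: eq_bigr => y _.
by rewrite exprMn [quad_char (t * y)]quad_charM !mulrA quad_char_sqr // mul1r.
Qed.

(** With [q = #|F|], the sum of [jacobsthal k ^+ 2] over all [k] is computed twice. Expanding and
    summing over [k] first gives [2q (q - 1)]: in [quad_char_corr] only [y = x] and [y = -x]
    survive, and its constant -1 drops out as the character sums to 0. On the other hand the square
    is constant on nonzero squares and on nonsquares. *)
Lemma jacobsthal_sum_sqr (g : F) : ~~ odd n -> quad_char g = -1 ->
  jacobsthal 1 ^+ 2 + jacobsthal g ^+ 2 = 4%:R * #|F|%:Z.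
Proof.
move=> en cg.
have cN1 : quad_char (-1) = 1.
  by rewrite /quad_char oppr_eq0 oner_eq0 -signr_odd (negPf en) eqxx.
have q1 : \sum_x quad_char x * quad_char x = n.*2%:Z.
  rewrite (bigD1 0) //= quad_char0 mul0r add0r.
  rewrite (eq_bigr (fun=> 1)) => [|k k0]; last by rewrite quad_char_sqr.
  rewrite sumr_const (_ : #|_| = #|F|.-1); last first.
    by rewrite -(cardC1 (0 : F)); apply: eq_card => x; rewrite !inE.
  by rewrite cardF /= natz.
have corr x y : quad_char x * quad_char y *
   \sum_k quad_char (1 - k * x ^+ 2) * quad_char (1 - k * y ^+ 2) =
   quad_char x * quad_char y * (#|F|%:Z * (x ^+ 2 == y ^+ 2)%:R - 1).
  have [->|x0] := eqVneq x 0; first by rewrite quad_char0 !mul0r.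
  have [->|y0] := eqVneq y 0; first by rewrite quad_char0 mulr0 !mul0r.
  congr (_ * _); rewrite -(inj_eq invr_inj) -quad_char_corr.
  have E k z : z != 0 -> quad_char (1 - k * z ^+ 2) = quad_char (k - (z ^+ 2)^-1).
    move=> z0; have -> : 1 - k * z ^+ 2 = -1 * (z * z) * (k - (z ^+ 2)^-1) by field.
    by rewrite 3!quad_charM cN1 quad_char_sqr // !mul1r.
  by apply: eq_bigr => k _; rewrite !E.
have S : \sum_k jacobsthal k ^+ 2 = 2%:R * #|F|%:Z * n.*2%:Z.
  transitivity (\sum_x \sum_y quad_char x * quad_char y *
   \sum_k quad_char (1 - k * x ^+ 2) * quad_char (1 - k * y ^+ 2)).
    rewrite [RHS](eq_bigr (fun x =>
      \sum_k quad_char x * quad_char (1 - k * x ^+ 2) * jacobsthal k)).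
      rewrite exchange_big /=; apply: eq_bigr => k _.
      by rewrite -mulr_suml expr2.
    move=> x _; under eq_bigr => y _ do rewrite mulr_sumr.
    rewrite exchange_big /=; apply: eq_bigr => k _.
    by rewrite mulr_sumr; apply: eq_bigr => y _; ring.
  rewrite -q1 mulr_sumr; apply: eq_bigr => x _.
  under eq_bigr => y _ do rewrite corr mulrBr mulr1.
  rewrite sumrB -mulr_sumr sum_quad_char mulr0 subr0.
  have [->|x0] := eqVneq x 0.
    by rewrite quad_char0 !mulr0 big1 // => y _; rewrite !mul0r.
  have xNx : x != - x by rewrite -addr_eq0 -mulr2n -mulr_natr mulf_neq0 // two_neq0.
  rewrite (bigD1 x) //= (bigD1 (- x)) /=; last by rewrite eq_sym.
  rewrite big1 => [|y /andP[yx yNx]]; last first.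
    by rewrite eq_sym eqf_sqr (negPf yx) (negPf yNx) !mulr0.
  have -> : quad_char (- x) = quad_char x by rewrite -mulN1r quad_charM cN1 mul1r.
  by rewrite sqrrN eqxx mulr1; ring.
have := sum_sqr_split (fun k => jacobsthal k ^+ 2) cg.
under eq_bigr => t _ do rewrite -[t ^+ 2]mul1r jacobsthal_scale exprMn.
under [X in _ + X]eq_bigr => t _ do rewrite jacobsthal_scale exprMn.
rewrite -!mulr_suml -mulrDr S q1 => E.
by apply: (mulfI (_ : n.*2%:Z != 0)); [lia | rewrite E; ring].
Qed.

Lemma exists_nonsquare : exists g : F, quad_char g = -1.
Proof.
have [g pg] := exists_prim_root; exists g; rewrite /quad_char.
have gn : g ^+ n != 1 by rewrite -(prim_order_dvd pg); apply/negP => /dvdn_leq; lia.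
by rewrite (negPf (prim_root_neq0 pg)) (negPf gn).
Qed.

Section EvenHalf.
Hypothesis en : ~~ odd n.

Lemma quad_charN (x : F) : quad_char (- x) = quad_char x.
Proof.
rewrite -mulN1r quad_charM /quad_char oppr_eq0 oner_eq0 -signr_odd (negPf en) eqxx.
by rewrite mul1r.
Qed.

Lemma quad_char_mul2 (y : F) : y ^+ 2 = -1 -> quad_char (2%:R * y) = 1.
Proof.
move=> y2; have -> : 2%:R * y = (1 + y) * (1 + y).
  by rewrite -expr2 sqrrD y2; ring.
rewrite quad_charM quad_char_sqr //; apply: contra_neq two_neq0 => /eqP.
rewrite addrC addr_eq0 => /eqP yE; move/eqP: y2.
by rewrite yE sqrrN expr1n -addr_eq0 => /eqP.
Qed.

(** If [y^2 = -1] then [2y] is a square, so [2^n y^n = 1], where [y^n = (-1)^(n/2)]. *)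
Lemma expf_two_half : 2%:R ^+ n = (-1) ^+ n./2 :> F.
Proof.
have [y /eqP y2] : exists y : F, y ^+ 2 == -1.
  have : 0 < #|[pred t : F | t ^+ 2 == -1]|%:Z.
    by rewrite card_sqrt quad_charN quad_char1.
  by rewrite ltz_nat => /card_gt0P[y]; rewrite inE => y2; exists y.
have := quad_char_exp (2%:R * y); rewrite quad_char_mul2 // exprMn.
have -> : y ^+ n = (-1) ^+ n./2.
  by rewrite -y2 -exprM mul2n; congr (_ ^+ _); have := odd_double_half n; lia.
move=> E; apply: (mulIf (_ : (-1) ^+ n./2 != 0)); first by rewrite signr_eq0.
by rewrite -E -expr2 sqrr_sign.
Qed.

(** The summand [f] is 0 at 0, 1, -1 and is 1 or -1 elsewhere, so the sum is [#|F| - 3 - 2 #|B|]. It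
    is invariant under [y -> -y] and [y -> 1/y], and the fibres of [u] on [B] are the orbits, of
    size 4; hence 4 divides [#|B|]. *)
Lemma jacobsthal_mod8 : exists c : int, jacobsthal 1 = n.*2%:Z - 2 + 8%:R * c.
Proof.
pose f (y : F) := quad_char y * quad_char (1 - y ^+ 2).
pose u (y : F) := y ^+ 2 + y ^- 2.
pose B := [set y | f y == -1].
have fN y : f (- y) = f y by rewrite /f quad_charN sqrrN.
have fV y : f y^-1 = f y.
  have [->|y0] := eqVneq y 0; first by rewrite invr0.
  rewrite /f -quad_charM -[RHS]mul1r -(quad_char_sqr (invr_neq0 y0)) -2!quad_charM.
  rewrite -[RHS]mul1r -(quad_char_sqr (invr_neq0 y0)) -quad_charN -3!quad_charM.
  by congr quad_char; field.
(* The four points [y], [-y], [1/y], [-1/y] of [B] are distinct: [quad_char 2y = 1]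
   if [y^2 = -1], since then [2y = (1 + y)^2]. *)
have card_fib y : y \in B -> #|[set z in B | u z == u y]| = 4.
  move=> yB.
  have : f y = -1 by apply/eqP; rewrite inE in yB.
  move=> fy.
  have y0 : y != 0.
    by apply: contra_eqN fy => /eqP ->; rewrite /f quad_char0 mul0r.
  have y1 : y ^+ 2 != 1.
    by apply: contra_eqN fy => /eqP yy; rewrite /f yy subrr quad_char0 mulr0.
  have yN1 : y ^+ 2 != -1.
    apply: contra_eqN fy => /eqP yy; rewrite /f yy opprK -quad_charM mulrC.
    by rewrite quad_char_mul2.
  have -> : [set z in B | u z == u y] = [set z in [:: y; - y; y^-1; - y^-1]].
    apply/setP => z; rewrite !inE; apply/andP/idP => [[fz uz]|].
      have z0 : z != 0.
        by apply: contraTneq fz => ->; rewrite /f quad_char0 mul0r.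
      have : (z ^+ 2 - y ^+ 2) * (z ^+ 2 - y^-1 ^+ 2) == 0.
        rewrite (_ : _ * _ = z ^+ 2 * (u z - u y)); last by rewrite /u; field; rewrite y0.
        by rewrite (eqP uz) subrr mulr0.
      by rewrite mulf_eq0 !subr_eq0 !eqf_sqr -!orbA.
    have uN x : u (- x) = u x by rewrite /u sqrrN.
    have uV x : u x^-1 = u x by rewrite /u exprVn invrK addrC.
    by case/or4P => /eqP ->; rewrite ?fN ?fV ?uN ?uV fy !eqxx.
  rewrite cardsE; apply/card_uniqP.
  have N (x : F) : x != 0 -> x != - x.
    by move=> x0; rewrite -addr_eq0 -mulr2n -mulr_natr mulf_neq0 // two_neq0.
  have yV : y != y^-1.
    by apply: contra_neq y1 => yE; rewrite expr2 {2}yE mulfV.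
  have yNV : y != - y^-1.
    by apply: contra_neq yN1 => yE; rewrite expr2 {2}yE mulrN mulfV.
  rewrite /= !inE !negb_or yV yNV N // eqr_opp yV eqr_oppLR yNV.
  by rewrite N // invr_eq0.
have [c cB] : exists c : nat, #|B| = (4 * c)%N.
  suff /dvdnP[c cB] : (4 %| #|B|)%N by exists c; rewrite mulnC.
  rewrite -sum1_card (partition_big u (fun z => [exists y in B, u y == z])) /=.
    apply: dvdn_sum => z /existsP[y /andP[yB /eqP <-]].
    rewrite (eq_bigl (fun x => x \in [set z in B | u z == u y])) => [|x].
      by rewrite sum1_card card_fib.
    by rewrite !inE.
  by move=> y yB; apply/existsP; exists y; rewrite yB eqxx.
exists (- c%:Z).
pose Z := [set z in [:: 0; 1; -1 : F]].
have cZ : #|Z| = 3%N.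
  rewrite cardsE; apply/card_uniqP; rewrite /= !inE !negb_or.
  rewrite eq_sym oner_eq0 eq_sym oppr_eq0 oner_eq0 -addr_eq0.
  by rewrite -mulr2n two_neq0.
have E (y : F) : f y = 1 - (y \in Z)%:R - 2%:R * (y \in B)%:R.
  have fZ : (f y == 0) = (y \in Z).
    have q0 z : (quad_char z == 0) = (z == 0).
      by rewrite /quad_char; case: (z == 0); last case: ifP.
    by rewrite /f mulf_eq0 !q0 subr_eq0 [1 == _]eq_sym sqrf_eq1 !inE.
  have fv : [|| f y == 0, f y == 1 | f y == -1].
    by rewrite /f /quad_char; do 4?[case: ifP => _].
  rewrite -fZ [y \in B]inE.
  by case/or3P: fv => /eqP ->.
rewrite /jacobsthal (eq_bigr f) => [|y _]; last by rewrite mul1r.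
under eq_bigr => y _ do rewrite E.
rewrite !sumrB -mulr_sumr sumr_const cardF.
have SA (A : {set F}) : \sum_y (y \in A)%:R = #|A|%:Z.
  by rewrite -natr_sum natz -sum1_card [in RHS]big_mkcond /=; congr (_%:Z).
rewrite !SA cZ cB natz. 
lia.
Qed.
End EvenHalf.

End OddFiniteField.

(** * The truncated logarithm and the correction term of the Jacobi sum *)

Section FermatQuotient.
Variables (F : finFieldType) (m : nat).
Hypothesis cardF : #|F| = (4 * m).+1.
Hypothesis m_gt0 : (0 < m)%N.
Hypothesis natF_neq0 : forall k, (0 < k <= 4 * m)%N -> k%:R != 0 :> F.

(** The series of [log(1 - x)] truncated below degree [p = 4m + 1]. *)
Definition fermat_log (x : F) : F := - \sum_(j < 4 * m) x ^+ j.+1 / j.+1%:R.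

Let cardF' : #|F| = m.*2.*2.+1.
Proof. by rewrite cardF; congr _.+1; lia. Qed.

Let natF0 : (4 * m).+1%:R = 0 :> F.
Proof. by rewrite -(natF cardF'); congr (_%:R); lia. Qed.

(** The terms with denominators [k] and [p - k] are equal: both the denominator and the parity
    change sign. *)
Lemma fermat_logN1 : fermat_log (-1) = alt_harmonic F m.*2 *+ 2.
Proof.
rewrite /fermat_log -sumrN (_ : 4 * m = m.*2 + m.*2)%N; last by lia.
rewrite big_split_ord /= mulr2n; congr (_ + _).
  by apply: eq_bigr => j _; rewrite exprS mulN1r mulNr opprK.
rewrite (reindex_inj rev_ord_inj) /=; apply: eq_bigr => j _.
have jm : (j < m.*2)%N by case: j.
have -> : (m.*2 + (m.*2 - j.+1)).+1%N%:R = - j.+1%:R :> F.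
  by apply/eqP; rewrite -addr_eq0 -natrD -natF0; apply/eqP; congr (_%:R); lia.
rewrite invrN mulrN opprK; congr (_ / _).
by apply: eq_signr; lia.
Qed.

(** Expanding [(1 - x)^(2m - 1)] and the logarithm leaves power sums over [F], nonzero only for
    exponents divisible by [4m]. What survives is twice the sum of [sum_alt_bin_pred_inv],
    simplified by [4m = -1]. *)
Lemma sum_fermat_log :
  (\sum_x x ^+ (3 * m) * (1 - x) ^+ m.*2.-1 * fermat_log x) *+ 2 =
  (-1) ^+ m * 'C(m.*2, m)%:R * (4%:R - fermat_log (-1)).
Proof.
(* Exactly one denominator between 1 and [4m] completes [3m + i] to a multiple of [4m]: to [4m]
   itself if [i < m], to [8m] otherwise. *)
have inner (i : nat) : (i < m.*2)%N ->
   \sum_(j < 4 * m) (4 * m %| 3 * m + i + j.+1)%:R / j.+1%:R =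
   (if (i < m)%N then m - i else 5 * m - i)%N%:R^-1 :> F.
  move=> i2m; set k := if _ then _ else _.
  have k0 : (k.-1 < 4 * m)%N by rewrite /k; case: (ltnP i m); lia.
  rewrite (bigD1 (Ordinal k0)) //= big1 => [|j jk].
    rewrite prednK /k; last by case: (ltnP i m); lia.
    have -> : (4 * m %| 3 * m + i + (if (i < m)%N then m - i else 5 * m - i))%N.
      by case: (ltnP i m) => im; apply/dvdnP; [exists 1%N | exists 2]; lia.
    by rewrite addr0 mul1r.
  have j4 : (j < 4 * m)%N by case: j {jk}.
  rewrite (_ : (4 * m %| _)%N = false) ?mul0r //; apply/negP => /dvdnP[c cE].
  move/eqP: jk; apply; apply: val_inj => /=.
  have : (c = 1 \/ c = 2)%N by nia.
  by rewrite /k; case: (ltnP i m); case; lia.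
have -> : \sum_x x ^+ (3 * m) * (1 - x) ^+ m.*2.-1 * fermat_log x =
   \sum_(i < m.*2) (-1) ^+ i * 'C(m.*2.-1, i)%:R *
     \sum_(j < 4 * m) (4 * m %| 3 * m + i + j.+1)%:R / j.+1%:R.
  transitivity (\sum_x \sum_(i < m.*2) \sum_(j < 4 * m)
      - ((-1) ^+ i * 'C(m.*2.-1, i)%:R / j.+1%:R * x ^+ (3 * m + i + j.+1)) : F).
    apply: eq_bigr => x _; rewrite expr_one_sub prednK; last by lia.
    rewrite mulr_sumr mulr_suml; apply: eq_bigr => i _.
    rewrite /fermat_log mulrN mulr_sumr -sumrN; apply: eq_bigr => j _.
    by rewrite !exprD; congr (- _); ring.
  rewrite exchange_big /=; apply: eq_bigr => i _.
  rewrite exchange_big mulr_sumr /=; apply: eq_bigr => j _.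
  rewrite sumrN -mulr_sumr (sum_expf cardF') //; try lia.
  by rewrite mulrN opprK (_ : m.*2.*2 = 4 * m)%N; [ring | lia].
under eq_bigr => i _ do rewrite inner //.
pose A := \sum_(i < m) (-1) ^+ i * 'C(m.*2.-1, i)%:R / (m - i)%:R : F.
(* The reflection [i -> 2m - 1 - i] maps the second half to the first: the sign changes, and so does
   the denominator, because [3m + 1 + i = -(m - i)] in [F]. *)
have -> : \sum_(i < m.*2) (-1) ^+ i * 'C(m.*2.-1, i)%:R /
    (if (i < m)%N then m - i else 5 * m - i)%N%:R = A + A.
  pose G (i : nat) : F := (-1) ^+ i * 'C(m.*2.-1, i)%:R /
    (if (i < m)%N then m - i else 5 * m - i)%N%:R.
  transitivity (\sum_(i < m + m) G i); first by rewrite addnn.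
  rewrite big_split_ord /G /=; congr (_ + _).
    by apply: eq_bigr => i _; rewrite ltn_ord.
  rewrite (reindex_inj rev_ord_inj) /=; apply: eq_bigr => i _.
  have im : (i < m)%N by case: i.
  rewrite ltnNge leq_addr /=.
  have -> : (5 * m - (m + (m - i.+1)))%N%:R = - (m - i)%:R :> F.
    by apply/eqP; rewrite -addr_eq0 -natrD -natF0; apply/eqP; congr (_%:R); lia.
  have -> : (m + (m - i.+1) = m.*2.-1 - i)%N by lia.
  rewrite bin_sub; last by lia.
  rewrite invrN mulrN -mulNr -mulNr; congr (_ * _ / _).
  by rewrite -mulN1r -exprS; apply: eq_signr; lia.
have nz k : (0 < k <= m.*2)%N -> k%:R != 0 :> F by move=> ?; apply: natF_neq0; lia.
have := sum_alt_bin_pred_inv m_gt0 nz.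
rewrite -/A fermat_logN1.
have m4 : 4%:R * m%:R = -1 :> F.
  by apply/eqP; rewrite -addr_eq0 -natrM natr1 natF0.
rewrite m4 mulN1r => /eqP; rewrite eqr_oppLR => /eqP ->.
rewrite -mul2n natrM.
move: (alt_harmonic _ _) => L.
transitivity ((-1) ^+ m * 'C(2 * m, m)%:R * (2%:R * L * (4%:R * m%:R) + 4%:R)).
  ring.
by rewrite m4; ring.
Qed.

End FermatQuotient.

(** * Jacobi sum modulo the square of a prime *)

Section Teichmuller.
Variables (p : nat) (R : comUnitRingType).
Hypotheses (pp : prime p) (podd : odd p).
Hypothesis pR0 : p%:R * p%:R = 0 :> R.

Let F := 'F_p.
Let p_gt0 : (0 < p)%N := prime_gt0 pp.

Lemma exprD_sqr0 (a e : R) (k : nat) : e * e = 0 ->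
  (a + e) ^+ k = a ^+ k + k%:R * a ^+ k.-1 * e.
Proof.
move=> e0; elim: k => [|k IH]; first by rewrite !mul0r addr0.
rewrite exprS IH -natr1 /=; case: k {IH} => [|k].
  by rewrite /= !expr0 expr1; ring.
rewrite exprS -[_.+1.-1]/k mulrDl !mulrDr.
have -> : e * (k.+1%:R * a ^+ k * e) = 0.
  by transitivity (k.+1%:R * a ^+ k * (e * e)); [ring | rewrite e0 mulr0].
by rewrite !exprS; ring.
Qed.

Lemma Fp_intr_eq (a b : int) : a%:~R = b%:~R :> F -> exists c : int, a = b + p%:Z * c.
Proof.
move/eqP; rewrite -subr_eq0 -intrB -(dvdz_pcharf (pchar_Fp pp)) => /dvdzP[c E].
by exists c; rewrite -[LHS](subrK b) E addrC mulrC.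
Qed.

Lemma Fp_valK (x : F) : (x : nat)%:Z%:~R = x.
Proof. by rewrite -pmulrn natr_Zp. Qed.

Let valE (x : F) : (x : nat)%:R = (x : nat)%:Z%:~R :> R.
Proof. exact: pmulrn. Qed.

Let Fp_expp (x : F) : x ^+ p = x.
Proof. by have := expf_card x; rewrite (card_Fp pp). Qed.

(* As [p^2 = 0] in [R], both [p * x] and [x ^ p] depend only on [x] modulo [p]. *)
Definition pmul (x : F) : R := p%:R * (x : nat)%:R.

Lemma pmul_int (z : int) : pmul z%:~R = p%:R * z%:~R.
Proof.
rewrite /pmul valE; have [c ->] := Fp_intr_eq (Fp_valK z%:~R).
by rewrite intrD intrM mulrDr mulrA pR0 mul0r addr0.
Qed.

Lemma pmulD : {morph pmul : x y / x + y}.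
Proof.
move=> x y; rewrite -[x in LHS]Fp_valK -[y in LHS]Fp_valK -intrD pmul_int intrD mulrDr.
by rewrite /pmul !valE.
Qed.

Lemma pmul0 : pmul 0 = 0.
Proof. by rewrite -[0]/(0%:~R) pmul_int mulr0. Qed.

Lemma pmulMz (x : F) (z : int) : pmul (x * z%:~R) = pmul x * z%:~R.
Proof. by rewrite -[x in LHS]Fp_valK -intrM pmul_int intrM mulrA /pmul valE. Qed.

Lemma pmulN (x : F) : pmul (- x) = - pmul x.
Proof. by rewrite -mulrN1 -[-1]/((-1)%:~R) pmulMz mulrN1. Qed.

Lemma pmul_sqr (x : F) : pmul x * pmul x = 0.
Proof. by rewrite /pmul mulrACA pR0 mul0r. Qed.

Definition teich (x : F) : R := (x : nat)%:R ^+ p.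

(** Changing an integer lift by [p c] changes its [p]-th power by a multiple of [p^2]. *)
Lemma teich_int (z : int) : teich z%:~R = z%:~R ^+ p.
Proof.
rewrite /teich valE; have [c ->] := Fp_intr_eq (Fp_valK z%:~R).
rewrite intrD intrM exprD_sqr0; last by rewrite mulrACA pR0 mul0r.
by rewrite [p%:R * z%:~R ^+ _]mulrC -mulrA [p%:R * (_ * _)]mulrA pR0 mul0r mulr0 addr0.
Qed.

Lemma teichM : {morph teich : x y / x * y}.
Proof.
move=> x y; rewrite -[x in LHS]Fp_valK -[y in LHS]Fp_valK -intrM teich_int intrM exprMn.
by rewrite /teich !valE.
Qed.

Lemma teichX (x : F) (k : nat) : teich (x ^+ k) = teich x ^+ k.
Proof.
elim: k => [|k IH]; last by rewrite !exprS teichM IH.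
by rewrite !expr0 -[1]/(1%:~R) teich_int expr1n.
Qed.

Lemma teich_expp (x : F) : teich x ^+ p = teich x.
Proof. by rewrite -teichX Fp_expp. Qed.

Lemma teich0 : teich 0 = 0.
Proof. by rewrite -[0]/(0%:~R) teich_int expr0n (gtn_eqF p_gt0). Qed.

Lemma teichE (x : F) : teich x = ((x : nat) ^ p)%N%:Z%:~R.
Proof. by rewrite /teich -natrX pmulrn. Qed.

(** By Fermat the [p]-th power of a lift is again a lift. As [teich x] is the image of this integer,
    it may replace [x] in [pmul] and in [teich]. *)
Lemma Fp_valX (x : F) : ((x : nat) ^ p)%N%:Z%:~R = x.
Proof. by rewrite -pmulrn natrX natr_Zp Fp_expp. Qed.

Lemma pmulM_teich (x y : F) : pmul (x * y) = pmul x * teich y.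
Proof. by rewrite -[y in LHS]Fp_valX pmulMz teichE. Qed.

Lemma pmulM_teich_exp (x y : F) k : pmul (x * y ^+ k) = pmul x * teich y ^+ k.
Proof. by rewrite pmulM_teich teichX. Qed.

Lemma pmulM_one_sub_teich (x y : F) (k : nat) :
  pmul (x * (1 - y) ^+ k) = pmul x * (1 - teich y) ^+ k.
Proof.
elim: k => [|k IH] in x *; first by rewrite !mulr1.
rewrite !exprS !mulrA IH; congr (_ * _).
rewrite -[y in LHS]Fp_valX -[1]/(1%:~R) -intrB pmulMz; congr (_ * _).
by rewrite intrB teichE.
Qed.

Lemma teich_one_sub (x : F) : teich (1 - x) = (1 - teich x) ^+ p.
Proof. by rewrite -[x in LHS]Fp_valX -[1]/(1%:~R) -intrB teich_int intrB teichE. Qed.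

(** The left side is an alternating partial sum of row [p], in which all terms but the first vanish
    modulo [p]. *)
Lemma signed_bin_pred_prime (k : nat) : (k < p)%N ->
  (-1) ^+ k * 'C(p.-1, k)%:R = 1 :> F.
Proof.
move=> kp; rewrite -sum_alt_bin prednK // (big_ord_recl) expr0 bin0 mulr1.
rewrite big1 ?addr0 // => i _.
have ip : (0 < bump 0 i < p)%N by case: i => i /= ik; rewrite /bump; lia.
have := prime_dvd_bin pp ip; rewrite (dvdn_pcharf (pchar_Fp pp)) => /eqP ->.
by rewrite mulr0.
Qed.

(** An inverse [w] modulo [p] gives [z w = 1 + p c], and [1 - p c] inverts the right side since
    [p^2 = 0]. *)
Lemma intr_unit (z : int) : z%:~R != 0 :> F -> (z%:~R : R) \is a GRing.unit.
Proof.
move=> z0; pose w : int := ((z%:~R^-1 : F) : nat)%:Z.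
have : (z * w)%:~R = (1 : int)%:~R :> F by rewrite intrM Fp_valK mulfV.
case/Fp_intr_eq => c /(congr1 (fun z : int => z%:~R : R)).
rewrite intrD !intrM -[p%:Z%:~R]pmulrn => E.
apply/unitrPr; exists (w%:~R * (1 - p%:R * c%:~R)).
rewrite mulrA E; transitivity (1 - p%:R * p%:R * c%:~R ^+ 2 : R); first by ring.
by rewrite pR0 mul0r subr0.
Qed.

Lemma natr_unit (k : nat) : ~~ (p %| k)%N -> (k%:R : R) \is a GRing.unit.
Proof.
by rewrite (dvdn_pcharf (pchar_Fp pp)) !pmulrn; apply: intr_unit.
Qed.

Lemma pmul_div_nat (x : F) (k : nat) : ~~ (p %| k)%N ->
  pmul (x / k%:R) * k%:R = pmul x.
Proof.
move=> k0; have := pmulMz (x / k%:R) k%:Z; rewrite -!pmulrn => <-.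
by rewrite mulfVK // -(dvdn_pcharf (pchar_Fp pp)).
Qed.

(** * Evaluation of the Jacobi sum for [p = 4m + 1] *)

Section Mod4.
Variable m : nat.
Hypothesis pE : p = (4 * m).+1.

Let m_gt0 : (0 < m)%N.
Proof. by have := prime_gt1 pp; lia. Qed.

Let cardF : #|F| = (4 * m).+1.
Proof. by rewrite card_Fp // pE. Qed.

Let cardF' : #|F| = m.*2.*2.+1.
Proof. by rewrite cardF; congr _.+1; lia. Qed.

Let m2_gt0 : (0 < m.*2)%N.
Proof. by lia. Qed.

Let natF_neq0 (k : nat) : (0 < k <= 4 * m)%N -> k%:R != 0 :> F.
Proof.
by move=> k4; rewrite -(dvdn_pcharf (pchar_Fp pp)) gtnNdvd //; lia.
Qed.

Let natR_unit (k : nat) : (0 < k <= 4 * m)%N -> (k%:R : R) \is a GRing.unit.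
Proof. by move=> k4; rewrite natr_unit // gtnNdvd //; lia. Qed.

(** In the expansion of [(1 - teich x)^p] the two end terms give [1 - teich x]. For [0 < j < p],
    [C(p, j) = (p/j) C(p - 1, j - 1)], and [C(p - 1, j - 1)] matters only modulo [p], where it is a
    sign; the signed coefficient is [-p/j]. *)
Lemma teich_one_sub_log (x : F) :
  teich (1 - x) = 1 - teich x + pmul (fermat_log m x).
Proof.
have -> : teich (1 - x) = \sum_(i < (4 * m).+2) (-1) ^+ i * 'C(p, i)%:R * teich x ^+ i.
  by rewrite teich_one_sub expr_one_sub pE.
rewrite big_ord_recl big_ord_recr /= (_ : bump 0 (4 * m) = p); last by rewrite pE.
rewrite bin0 binn teich_expp !mulr1.
rewrite expr0 -[(-1) ^+ p]signr_odd podd expr1 mulN1r addrCA addrC; congr (_ + _).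
rewrite /fermat_log pmulN (big_morph pmul pmulD pmul0) -sumrN.
apply: eq_bigr => j _; have j4 : (j < 4 * m)%N by case: j.
rewrite /bump add1n.
have uj := natR_unit (_ : (0 < j.+1 <= 4 * m)%N); apply: (mulIr (uj _)); first by lia.
rewrite mulNr pmul_div_nat; last by rewrite gtnNdvd //; lia.
have := mul_bin_diag p j => /(congr1 (fun k : nat => k%:R : R)); rewrite !natrM => E.
transitivity ((-1) ^+ j.+1 * (j.+1%:R * 'C(p, j.+1)%:R) * teich x ^+ j.+1); first by ring.
rewrite -E -[x ^+ _]mul1r pmulM_teich_exp.
have -> : pmul 1 = (-1) ^+ j * (p%:R * 'C(p.-1, j)%:R).
  rewrite -(@signed_bin_pred_prime j); last by lia.
  transitivity (pmul (((-1) ^+ j * 'C(p.-1, j)%:Z)%:~R)).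
    by congr pmul; rewrite intrM rmorphXn /= rmorphN1 -pmulrn.
  by rewrite pmul_int intrM rmorphXn /= rmorphN1 -pmulrn; ring.
by rewrite exprS; ring.
Qed.

(** Euler's criterion lifts from [F] to [R] because 0, 1 and -1 are fixed by the [p]-th power. *)
Lemma quad_char_teich (x : F) : (quad_char m.*2 x)%:~R = teich x ^+ m.*2.
Proof.
rewrite -teichX -(quad_char_exp cardF') // teich_int.
have : (quad_char m.*2 x) ^+ p = quad_char m.*2 x.
  rewrite /quad_char; case: ifP => _; first by rewrite expr0n (gtn_eqF p_gt0).
  by case: ifP => _; rewrite ?expr1n // -signr_odd podd.
by move=> E; rewrite -{1}E rmorphXn.
Qed.

Lemma sum_teich (k : nat) : (0 < k)%N ->
  \sum_x teich x ^+ k = (4 * m)%:R * (4 * m %| k)%:R.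
Proof.
move=> k0; have [g pg] := exists_prim_root cardF' m2_gt0.
have [dv|ndv] := boolP (4 * m %| k)%N.
  rewrite (bigD1 0) //= teich0 expr0n (gtn_eqF k0) add0r mulr1.
  rewrite (eq_bigr (fun=> 1)) => [|x x0]; last first.
    have [c ->] := dvdnP dv; rewrite -teichX mulnC exprM.
    rewrite (_ : 4 * m = m.*2.*2)%N; last by lia.
    by rewrite (expf_order cardF') // expr1n -[1]/(1%:~R) teich_int expr1n.
  rewrite sumr_const (_ : #|_| = #|F|.-1); last first.
    by rewrite -(cardC1 (0 : F)); apply: eq_card => x; rewrite !inE.
  by rewrite cardF.
rewrite mulr0; have g0 := prim_root_neq0 m2_gt0 pg.
apply: (sum_multiplicative_eq0 (g := g)) => //.
  by move=> x y; rewrite teichM exprMn.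
rewrite -teichX teichE -[1]/(1%:~R) -intrB intr_unit // intrB Fp_valX.
by rewrite subr_eq0 -(prim_order_dvd pg) (_ : m.*2.*2 = 4 * m)%N //; lia.
Qed.

Definition jacobi_sum : R :=
  \sum_x teich x ^+ (3 * m) * (quad_char m.*2 (1 - x))%:~R.

(** By [teich_one_sub_log] the character of [1 - x] is the [2m]-th power of [1 - teich x] plus a
    square-zero element, hence has a two-term expansion. The first term is evaluated by power sums
    of [teich]. *)
Lemma jacobi_sum_eval : jacobi_sum =
  (4 * m)%:R * ((-1) ^+ m * 'C(m.*2, m)%:R) +
  pmul ((m.*2)%:R * \sum_x x ^+ (3 * m) * (1 - x) ^+ m.*2.-1 * fermat_log m x).
Proof.
rewrite mulr_sumr (big_morph pmul pmulD pmul0).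
transitivity (\sum_x teich x ^+ (3 * m) * (1 - teich x) ^+ m.*2 +
  \sum_(x : F) pmul ((m.*2)%:R * (x ^+ (3 * m) * (1 - x) ^+ m.*2.-1 * fermat_log m x))).
  rewrite -big_split /=; apply: eq_bigr => x _.
  rewrite quad_char_teich teich_one_sub_log exprD_sqr0 ?pmul_sqr // mulrDr; congr (_ + _).
  set f := fermat_log m x.
  have -> : (m.*2)%:R * (x ^+ (3 * m) * (1 - x) ^+ m.*2.-1 * f) =
     (f * x ^+ (3 * m)) * (1 - x) ^+ m.*2.-1 * (m.*2)%:Z%:~R by rewrite -pmulrn; ring.
  by rewrite pmulMz pmulM_one_sub_teich pmulM_teich_exp -pmulrn; ring.
congr (_ + _).
under eq_bigr => x _ do rewrite expr_one_sub mulr_sumr.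
rewrite exchange_big /=.
transitivity (\sum_(i < m.*2.+1) (-1) ^+ i * 'C(m.*2, i)%:R *
    ((4 * m)%:R * (4 * m %| 3 * m + i)%:R) : R).
  apply: eq_bigr => i _; rewrite -sum_teich ?mulr_sumr; last by lia.
  by apply: eq_bigr => x _; rewrite exprD; ring.
(* Of the exponents from [3m] to [5m] only [4m] is a multiple of [4m], which selects [i = m]. *)
have mm : (m < m.*2.+1)%N by lia.
rewrite (bigD1 (Ordinal mm)) //= big1 => [|i im].
  by rewrite (_ : 3 * m + m = 4 * m)%N ; [rewrite dvdnn mulr1 addr0; ring | lia].
rewrite (_ : (4 * m %| _)%N = false) ?mulr0 //; apply/negP => /dvdnP[c cE].
move/eqP: im; apply; apply: val_inj => /=.
have i2m : (i < m.*2.+1)%N by case: i {cE}.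
have : (c = 1)%N by nia.
by move=> c1; rewrite c1 in cE; lia.
Qed.

(** Write [teich 2 = 2 + P], using [2 = 1 - (-1)]. Its [2m]-th power is [(-1)^m] by [expf_two_half],
    and is also [2^(2m) + 2m 2^(2m - 1) P]; multiply by 4 and use [4m P = -P]. *)
Lemma teich_two : (2%:R : R) ^+ m.*2 *
  (4%:R - pmul (fermat_log m (-1))) = 4%:R * (-1) ^+ m.
Proof.
have tN1 : teich (-1) = -1.
  by rewrite -[-1]/((-1)%:~R) teich_int -signr_odd podd.
have t2 : teich 2%:R = 2%:R + pmul (fermat_log m (-1)).
  rewrite -[2%:R]/(1 + 1) -{1}[X in 1 + X]opprK teich_one_sub_log.
  by rewrite tN1 opprK.
have : teich 2%:R ^+ m.*2 = (-1) ^+ m.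
  rewrite -teichX (expf_two_half cardF') ?odd_double // doubleK.
  by rewrite teichX tN1.
rewrite t2 exprD_sqr0 ?pmul_sqr // => <-.
have p4 (x : F) : (4 * m)%:R * pmul x = - pmul x.
  have := pmulMz x (4 * m)%:Z; rewrite -!pmulrn => e4; rewrite mulrC -e4.
  rewrite -pmulN; congr pmul; apply/eqP; rewrite -addr_eq0 -{2}[x]mulr1 -mulrDr natr1 -pE.
  by rewrite pchar_Fp_0 // mulr0.
have -> : (2%:R : R) ^+ m.*2 = 2%:R * 2%:R ^+ m.*2.-1 by rewrite -exprS prednK.
move: (p4 (fermat_log m (-1))); rewrite -!mul2n !natrM => p4'.
set P := pmul _ in p4' *; set t := 2 ^+ _.
transitivity (2%:R * t * (4%:R + (4%:R * m%:R * P))); first by rewrite p4'; ring.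
by ring.
Qed.

(** The Jacobi sum contains the same factor [4 - pmul L] as [teich_two], so multiplication by
    [2^(2m)] removes the Fermat quotient. *)
Lemma jacobi_sum_bin : 2%:R ^+ m.*2 * jacobi_sum = - 'C(m.*2, m)%:R.
Proof.
have u4 : (4%:R : R) \is a GRing.unit by apply: natR_unit; lia.
apply: (mulrI u4); pose L := fermat_log m (-1 : F).
have J4 : 4%:R * jacobi_sum = - ((-1) ^+ m * 'C(m.*2, m)%:R * (4%:R - pmul L)).
  rewrite jacobi_sum_eval; set E := \sum_x _.
  have sE : E *+ 2 = _ := sum_fermat_log cardF m_gt0 natF_neq0.
  (* In the main term [4m] is needed modulo [p^2]: its part [p] cancels the [4p] of [pS]. In the
     correction, already divisible by [p], [4m = -1] suffices. *)
  have -> : (4 * m)%:R = p%:R - 1 :> R by rewrite [in RHS]pE -natr1 addrK.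
  have pE4 : 4%:R * pmul ((m.*2)%:R * E) = - (pmul (E *+ 2)).
    have := pmulMz ((m.*2)%:R * E) 4%:Z; rewrite -!pmulrn => e4; rewrite mulrC -e4.
    rewrite -pmulN; congr pmul; apply/eqP; rewrite -addr_eq0.
    have : (4 * m).+1%:R = 0 :> F by rewrite -pE pchar_Fp_0.
    rewrite -natr1 natrM -mul2n natrM => e.
    apply/eqP; transitivity (E *+ 2 * (4%:R * m%:R + 1)); first by ring.
    by rewrite e mulr0.
  have pS : pmul (E *+ 2) = (-1) ^+ m * 'C(m.*2, m)%:R * (4%:R * p%:R - pmul L).
    rewrite sE.
    transitivity (pmul ((4%:R - L) * ((-1) ^+ m * 'C(m.*2, m)%:Z)%:~R)).
      by congr pmul; rewrite intrM rmorphXn /= rmorphN1 -pmulrn; ring.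
    rewrite pmulMz pmulD pmulN -[4%:R]/(4%:Z%:~R) pmul_int intrM.
    rewrite rmorphXn /= rmorphN1 -!pmulrn.
    by ring.
  by rewrite mulrDr pE4 pS; ring.
rewrite mulrCA J4.
transitivity (- ((-1) ^+ m * 'C(m.*2, m)%:R * (2%:R ^+ m.*2 * (4%:R - pmul L)))).
  by ring.
rewrite teich_two.
transitivity (- (4%:R * 'C(m.*2, m)%:R * ((-1) ^+ m * (-1) ^+ m)) : R).
  by ring.
by rewrite -expr2 sqrr_sign; ring.
Qed.

(** Substitute [x = t^2] and [x = g t^2]. The exponent doubles to [6m], and [teich t ^+ (6 m)] is
    the cube of the quadratic character, hence the character itself; at [g] it is -1. *)
Lemma jacobi_sum_jacobsthal (g : F) : quad_char m.*2 g = -1 ->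
  jacobi_sum *+ 2 =
    (jacobsthal m.*2 (1 : F))%:~R + teich g ^+ (3 * m) * (jacobsthal m.*2 g)%:~R
  /\ (teich g ^+ (3 * m)) ^+ 2 = -1.
Proof.
move=> cg.
have c6 x : teich x ^+ (3 * m) * teich x ^+ (3 * m) = (quad_char m.*2 x)%:~R.
  rewrite -exprD (_ : 3 * m + 3 * m = m.*2 * 3)%N; last by lia.
  rewrite exprM -quad_char_teich -rmorphXn /=; congr (_%:~R).
  by rewrite /quad_char; case: ifP => // _; case: ifP.
split; last by rewrite expr2 c6 cg rmorphN1.
rewrite /jacobi_sum -(sum_sqr_split cardF' m2_gt0 _ cg); congr (_ + _).
  rewrite rmorph_sum; apply: eq_bigr => t _.
  by rewrite teichX -exprM mulnC exprM expr2 -exprMn expr2 /= intrM mul1r exprMn c6.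
rewrite rmorph_sum mulr_sumr; apply: eq_bigr => t _.
by rewrite teichM expr2 teichM !exprMn c6 /= intrM; ring.
Qed.

End Mod4.

End Teichmuller.

(** * Descent to the integers *)

(** The sum multiplied by [32^n]: an integer through which its values in the rationals and modulo
    [p^2] are compared. *)
Definition int_S32 (n : nat) : int :=
  \sum_(k < n.+1) ('C(k.*2, k) ^ 2)%:Z * 32%:Z ^+ (n - k).

Lemma int_S32E (A : comUnitRingType) (n : nat) : (32%:R : A) \is a GRing.unit ->
  (\sum_(k < n.+1) ('C(k.*2, k) ^ 2)%:R / 32%:R ^+ k) * 32%:R ^+ n =
  (int_S32 n)%:~R :> A.
Proof.
move=> u; rewrite /int_S32 rmorph_sum mulr_suml; apply: eq_bigr => k _ /=.
have kn : (k <= n)%N by case: k.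
have -> : 32%:R ^+ n = 32%:R ^+ k * 32%:R ^+ (n - k) :> A by rewrite -exprD subnKC.
by rewrite intrM rmorphXn /= -!pmulrn mulrA mulrVK // unitrX.
Qed.

(** Lets a congruence be read off any fraction [N/D] with [D] prime to [M]: the reduced denominator
    divides [D], and [M] divides [numq z D], hence [numq z]. *)
Lemma rat_eqmod_int (M : nat) (x y : rat) (D N : int) :
  (x - y) * D%:~R = N%:~R -> coprime M `|D|%N -> (M%:Z %| N)%Z -> rat_eqmod M x y.
Proof.
rewrite /rat_eqmod; move: (x - y) => z zD cMD MN.
have E : numq z * D = N * denq z.
  apply: (@intr_inj rat); rewrite !intrM -zD -{2}[z]divq_num_den.
  by rewrite mulrAC divfK ?intr_eq0 ?denq_neq0.
have dD : (denq z %| D)%Z.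
  have : (denq z %| numq z * D)%Z by rewrite E dvdz_mull.
  rewrite Gauss_dvdzr // /coprimez /gcdz gcdnC.
  by have := coprime_num_den z; rewrite /coprime => /eqP ->.
apply/andP; split; first by apply: coprime_dvdr cMD; rewrite dvdzE in dD.
have : (M%:Z %| numq z * D)%Z by rewrite E dvdz_mulr.
by rewrite Gauss_dvdzl // /coprimez /gcdz.
Qed.

Lemma Zp_intr_eq0 (N : nat) (z : int) : (1 < N)%N -> z%:~R = 0 :> 'Z_N -> (N%:Z %| z)%Z.
Proof.
move=> N1 z0; have : `|z|%N%:R = 0 :> 'Z_N.
  by rewrite pmulrn abszE normrEsign intrM z0 mulr0.
move/(congr1 val); rewrite /= val_Zp_nat // => /eqP zN.
by rewrite dvdzE.
Qed.

(** [p] divides [(ad - bc) (ad + bc)]; by the sign of [d], let [ad - bc = kp]. Then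
    [p^2 = (ac + bd)^2 + (kp)^2]. If [k = 0] the squares agree; otherwise [ac + bd = 0], which gives
    [p = a^2 + c^2], even for odd [a] and [c]. *)
Lemma sum_two_squares_uniq (p : nat) (a b c d : int) : prime p -> odd p ->
  p%:Z = a ^+ 2 + b ^+ 2 -> p%:Z = c ^+ 2 + d ^+ 2 ->
  ~~ (2 %| a)%Z -> ~~ (2 %| c)%Z -> a ^+ 2 = c ^+ 2.
Proof.
move=> pp podd ab cd ao co.
have p0 : p%:Z != 0 by have := prime_gt0 pp; lia.
wlog pd : d cd / (p%:Z %| a * d - b * c)%Z.
  move=> IH.
  have : (p%:Z %| (a * d - b * c) * (a * d + b * c))%Z.
    have -> : (a * d - b * c) * (a * d + b * c) = p%:Z * (a ^+ 2 - c ^+ 2).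
      transitivity (a ^+ 2 * (c ^+ 2 + d ^+ 2) - (a ^+ 2 + b ^+ 2) * c ^+ 2).
        by ring.
      by rewrite -ab -cd; ring.
    exact: dvdz_mulr.
  rewrite dvdzE abszM Euclid_dvdM // => /orP[] pd; first exact: (IH d).
  apply: (IH (- d)); first by rewrite sqrrN.
  by rewrite (_ : _ - _ = - (a * d + b * c)); [rewrite dvdzE abszN | ring].
have /dvdzP[k kE] := pd.
have p2 : p%:Z ^+ 2 = (a * c + b * d) ^+ 2 + (k * p%:Z) ^+ 2.
  by rewrite -kE expr2 {1}ab cd; ring.
have [k0|k0] := eqVneq k 0.
  apply: (mulfI p0).
  transitivity (a ^+ 2 * (c ^+ 2 + d ^+ 2) - ((a * d - b * c) * (a * d + b * c))).
    by rewrite -cd kE k0; ring.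
  transitivity ((a ^+ 2 + b ^+ 2) * c ^+ 2); first by ring.
  by rewrite -ab.
have X0 : (a * c + b * d) ^+ 2 = 0.
  apply/eqP; rewrite eq_le sqr_ge0 andbT.
  have -> : (a * c + b * d) ^+ 2 = p%:Z ^+ 2 * (1 - k ^+ 2).
    by rewrite mulrBr mulr1 {1}p2; ring.
  rewrite mulr_ge0_le0 ?sqr_ge0 // subr_le0 -gtz0_ge1.
  by rewrite lt_neqAle sqr_ge0 eq_sym sqrf_eq0 k0.
move/eqP: X0; rewrite sqrf_eq0 addr_eq0 => /eqP X0.
have : p%:Z * p%:Z = p%:Z * (a ^+ 2 + c ^+ 2).
  have : (a * c) ^+ 2 = (p%:Z - a ^+ 2) * (p%:Z - c ^+ 2).
    by rewrite X0 {1}ab cd; ring.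
  move/eqP; rewrite eq_sym -subr_eq0 => /eqP h.
  by apply/eqP; rewrite -subr_eq0 -h; apply/eqP; ring.
move/(mulfI p0) => pac; exfalso.
have odd_sq (x : int) : ~~ (2 %| x)%Z -> exists y, x ^+ 2 = 2 * y + 1.
  move=> x2; exists (2 * (x %/ 2)%Z ^+ 2 + 2 * (x %/ 2)%Z).
  have {1}-> : x = 2 * (x %/ 2)%Z + 1 by move: x2; clear; lia.
  by ring.
have [y yE] := odd_sq _ ao; have [z zE] := odd_sq _ co.
by move: podd pac; rewrite yE zE; clear; lia.
Qed.

(** Modulo 4, [2m - 1] is [-(-1)^m], which decides between [a] and [-a]. *)
Lemma eq_sqr_sign_mod4 (m : nat) (a c k : int) :
  (4 %| a - 1)%Z -> c = m.*2%:Z - 1 + 4 * k -> a ^+ 2 = c ^+ 2 -> c = - (-1) ^+ m * a.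
Proof.
move=> /dvdzP[j aE] cE /eqP; rewrite eqf_sqr.
have {}aE : a = 1 + 4 * j by lia.
have mE : m.*2%:Z = 2 * (odd m + (m./2).*2)%N%:Z by have := odd_double_half m; lia.
rewrite -signr_odd; move: mE; case: (odd m) => mE /orP[]/eqP.
- by rewrite expr1 opprK mul1r.
- by move: mE; rewrite cE aE; clear; lia.
- by move: mE; rewrite cE aE; clear; lia.
- by rewrite expr0 mulN1r => ->; rewrite opprK.
Qed.

Lemma prime_ndvd_fact (p k : nat) : prime p -> (k < p)%N -> ~~ (p %| k`!)%N.
Proof.
move=> pp; elim: k => [|k IH] kp; first by rewrite dvdn1; have := prime_gt1 pp; lia.
by rewrite factS Euclid_dvdM // negb_or gtnNdvd // IH // ltnW.
Qed.

(* The unit root [Q] of [X^2 - 2aX + p] is [2a - p/(2a)] when [p^2 = 0]. *)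
Lemma unit_root_sqr0 (A : comUnitRingType) (p a Q : A) :
    p * p = 0 -> Q \is a GRing.unit -> Q * Q = 2%:R * a * Q - p ->
  2%:R * a * Q = 4%:R * a ^+ 2 - p.
Proof.
move=> p2 uQ QQ.
have Qp : (Q - 2%:R * a) * Q = - p by rewrite mulrBl QQ; ring.
have : (Q - 2%:R * a) ^+ 2 = 0.
  apply: (mulIr (unitrX 2 uQ)); rewrite mul0r -exprMn Qp.
  by rewrite sqrrN expr2.
have -> : (Q - 2%:R * a) ^+ 2 = Q * Q - 4%:R * a * Q + 4%:R * a ^+ 2 by ring.
move=> h; apply/eqP; rewrite -subr_eq0 -oppr_eq0 -h QQ; apply/eqP; ring.
Qed.

(** * The two residue classes of [p] modulo 4 *)

Section ModSquarePrime.
Variable p : nat.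
Hypotheses (pp : prime p) (podd : odd p).

Let n := (p.-1)./2.
Let R := 'Z_(p ^ 2).

Let pn : p = n.*2.+1.
Proof. by rewrite /n; have := prime_gt1 pp; lia. Qed.

Let p2_gt1 : (1 < p ^ 2)%N.
Proof. by rewrite (ltn_exp2l 0) ?prime_gt1. Qed.

Lemma Zp_sqr0 : p%:R * p%:R = 0 :> R.
Proof. by rewrite -natrM mulnn pchar_Zp. Qed.

(** For [x = X/D] the difference has denominator [32^n D], prime to [p]; its numerator is shown to
    vanish in [R], where [sum_central_bin] evaluates the sum. *)
Lemma S32_eqmod (x : rat) (D X : int) :
    x * D%:~R = X%:~R -> coprime p `|D|%N ->
    D%:~R * (2%:R ^- n * (if odd n then 0 else (-1) ^+ n./2 * 'C(n, n./2)%:R)) =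
      X%:~R :> R ->
  rat_eqmod (p ^ 2) (S32 p) x.
Proof.
move=> xD cD XR.
have c2 : coprime p 2 by rewrite coprimen2.
have unR j : (0 < j <= n.*2)%N -> (j%:R : R) \is a GRing.unit.
  by move=> hj; apply: (natr_unit pp Zp_sqr0); rewrite gtnNdvd //; lia.
have u2 : (2%:R : R) \is a GRing.unit.
  by apply: (natr_unit pp Zp_sqr0); rewrite -prime_coprime.
have u32 : (32%:R : R) \is a GRing.unit.
  by rewrite (_ : 32 = 2 ^ 5)%N // natrX unitrX.
apply: (@rat_eqmod_int _ _ _ (32%:Z ^+ n * D) (int_S32 n * D - 32%:Z ^+ n * X)).
- rewrite /S32 -/n intrB !intrM -int_S32E ?unitfE // -xD rmorphXn /= -pmulrn; ring.
- rewrite abszM abszX coprimeMr !coprimeXl // coprimeXr //.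
  by rewrite (_ : `|32%:Z|%N = 2 ^ 5)%N // coprimeXr.
apply: Zp_intr_eq0 => //.
rewrite intrB !intrM -int_S32E // -XR rmorphXn /= -pmulrn sum_central_bin //.
  by set V := _ ^- n * _; rewrite [V * _]mulrC -mulrA [V * _]mulrC subrr.
by rewrite -pn expr2 Zp_sqr0.
Qed.

Lemma S32_eqmod_3mod4 : (p %% 4 = 3)%N -> rat_eqmod (p ^ 2) (S32 p) 0.
Proof.
move=> p4; apply: (@S32_eqmod 0 1 0); rewrite ?mul0r ?coprimen1 //.
by rewrite (_ : odd n) ?mulr0 //; rewrite /n; lia.
Qed.

Lemma S32_eqmod_1mod4 (a b : int) : (p %% 4 = 1)%N ->
  p%:Z = a ^+ 2 + b ^+ 2 -> (4 %| a - 1)%Z ->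
  rat_eqmod (p ^ 2) (S32 p) (2%:R * a%:~R - p%:R / (2%:R * a%:~R)).
Proof.
move=> p4 ab a4.
have a_odd : ~~ (2 %| a)%Z by lia.
have a0 : a != 0 by lia.
pose m := (p %/ 4)%N.
have pE : p = (4 * m).+1 by rewrite /m; lia.
have nE : n = m.*2 by lia.
have cardF : #|'F_p| = m.*2.*2.+1 by rewrite card_Fp // -nE.
have m2 : (0 < m.*2)%N by have := prime_gt1 pp; lia.
have em : ~~ odd m.*2 by rewrite odd_double.
have [g cg] := exists_nonsquare cardF m2.
have [J2 e2] := jacobi_sum_jacobsthal pp podd Zp_sqr0 pE cg.
have [c' cE] := jacobsthal_mod8 cardF m2 em.
have := jacobsthal_sum_sqr cardF m2 em cg; rewrite card_Fp // => PP.
have JB := jacobi_sum_bin pp podd Zp_sqr0 pE.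
set J := jacobi_sum _ _ _ in J2 JB; set e := teich _ _ ^+ _ in J2 e2.
set P1 := jacobsthal _ 1 in J2 cE PP; set P2 := jacobsthal _ g in J2 PP.
(* Half of [jacobsthal 1]; the factor 8 in [jacobsthal_mod8] becomes 4 and fixes [c] modulo 4. *)
pose c : int := (m.*2)%:Z - 1 + 4 * c'.
have P1c : P1 = 2 * c by rewrite cE /c; lia.
have [d P2d] : exists d, P2 = 2 * d.
  suff /dvdzP[d ->] : (2 %| P2)%Z by exists d; rewrite mulrC.
  apply/negP => /negP P2o.
  pose q := (P2 %/ 2)%Z; have P2q : P2 = 2 * q + 1 by rewrite /q; lia.
  by move: PP; rewrite P1c P2q; lia.
have pcd : p%:Z = c ^+ 2 + d ^+ 2 
  by apply: (mulfI (_ : 4%:R != 0 :> int)); rewrite // -PP P1c P2d; ring.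
have c_odd : ~~ (2 %| c)%Z by rewrite /c -mul2n; clear; lia.
have cs : c = - (-1) ^+ m * a.
  exact: eq_sqr_sign_mod4 a4 (erefl c) (sum_two_squares_uniq pp podd ab pcd a_odd c_odd).
have u2 : (2%:R : R) \is a GRing.unit.
  by apply: (natr_unit pp Zp_sqr0); rewrite -prime_coprime // coprimen2.
have JE : J = c%:~R + e * d%:~R.
  apply: (mulrI u2); rewrite mulr_natl J2 P1c P2d !intrM; ring.
(* As [e^2 = -1], [c + e d] is a root of [X^2 - 2cX + c^2 + d^2]. *)
have Jq : J * J = 2%:R * c%:~R * J - p%:R.
  have -> : p%:R = c%:~R ^+ 2 + d%:~R ^+ 2 :> R.
    by rewrite -!rmorphXn -rmorphD /= -pcd pmulrn.
  have -> : c%:~R ^+ 2 + d%:~R ^+ 2 = c%:~R ^+ 2 - e ^+ 2 * d%:~R ^+ 2 :> R.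
    by rewrite e2; ring.
  by rewrite JE; ring.
have Ju : J \is a GRing.unit.
  have : 2%:R ^+ m.*2 * J \is a GRing.unit.
    rewrite JB unitrN; apply: (natr_unit pp Zp_sqr0).
    apply/negP => pC; have : (p %| (m.*2)`!)%N.
      by rewrite -(@bin_fact m.*2 m) ?dvdn_mulr //; lia.
    by apply/negP/prime_ndvd_fact => //; rewrite pE; clear; lia.
  by rewrite unitrM => /andP[].
(* The sign that relates [c] to [a] turns the quadratic equation of [J] into [X^2 - 2aX + p]. *)
pose Q := - (-1) ^+ m * J.
have s2 : (-1) ^+ m * (-1) ^+ m = 1 :> R by rewrite -expr2 sqrr_sign.
have cR : c%:~R = - (-1) ^+ m * a%:~R :> R.
  by rewrite cs intrM rmorphN rmorphXn /= rmorphN1.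
have Qu : Q \is a GRing.unit by rewrite /Q mulNr unitrN unitrM Ju unitrX ?unitrN1.
have QQ : Q * Q = 2%:R * a%:~R * Q - p%:R.
  rewrite /Q mulrACA mulrNN s2 mul1r Jq cR; congr (_ - _).
  by rewrite -!mulrA; congr (_ * _); rewrite mulrCA.
have a2Q := unit_root_sqr0 Zp_sqr0 Qu QQ.
have a0Q : a%:~R != 0 :> rat by rewrite intr_eq0.
(* The target [2a - p/(2a)] is the fraction [(4a^2 - p) / (2a)]. *)
apply: (@S32_eqmod _ (2 * a) (4 * a ^+ 2 - p%:Z)).
- by rewrite !(intrM, intrB, rmorphXn) /= -pmulrn; field.
- rewrite abszM coprimeMr coprimen2 podd prime_coprime //=.
  (* If [p] divided [a], then [a^2 >= 2p], against [a^2 + b^2 = p]. *)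
  apply/negP => /dvdn_leq pa; have {}pa : (p <= `|a|)%N by apply: pa; rewrite absz_gt0.
  have p1 := prime_gt1 pp; have b2 := sqr_ge0 b.
  have q2 : (p * 2 <= `|a| * `|a|)%N by rewrite leq_mul // (leq_trans p1).
  have aa : a ^+ 2 = (`|a| * `|a|)%N%:Z by rewrite mulnn -abszX abszE ger0_norm ?sqr_ge0.
  by move: ab p1 b2 q2; rewrite aa; clear; lia.
rewrite nE odd_double doubleK.
have -> : 2%:R ^- m.*2 * ((-1) ^+ m * 'C(m.*2, m)%:R) = Q.
  apply: (mulrI (unitrX m.*2 u2)); rewrite mulVKr ?unitrX //.
  by rewrite /Q mulNr mulrN mulrCA JB mulrN opprK.
by rewrite intrM a2Q !(intrM, intrB, rmorphXn) /= -pmulrn.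
Qed.

End ModSquarePrime.

Theorem theorem2p2 (p : nat) (pp : prime p) (podd : odd p) :
  ((p %% 4 = 3)%N -> rat_eqmod (p ^ 2) (S32 p) 0) /\
  ((p %% 4 = 1)%N -> forall a b : int,
     p%:Z = a ^+ 2 + b ^+ 2 -> (4 %| a - 1)%Z ->
     rat_eqmod (p ^ 2) (S32 p)
       (2%:R * a%:~R - p%:R / (2%:R * a%:~R) : rat)).
Proof.
split; first exact: S32_eqmod_3mod4.
by move=> p4 a b; apply: S32_eqmod_1mod4.
Qed.
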